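(* There exists an absolute constant $C$ such that the following holds. For every graph $G$ on $n$ vertices with $k \ge 1$ edges, if $m$ is a positive integer such that $m \geq C\big((nk)^{1/3} + k^{2/3} (\log k)^{1/3}\big)$, then there is a grid-drawing of $G$ in $[m]^3$.
   Context: For a positive integer $m$, $[m]=\{0,1,\ldots,m-1\}$. A grid-drawing of a graph $G$ in $[m]^3$ is a representation of $G$ in which the vertices are mapped to distinct points of $[m]^3\subseteq\mathbb{Z}^3$ and each edge is drawn as the straight-line segment between the images of its endpoints, such that (i) no edge's segment contains the image of a vertex not incident to that edge, and (ii) no two edges' segments share a common interior point. *)

(* Defs.v *)
From mathcomp Require Import all_boot all_order all_algebra.
From mathcomp Require Import all_classical all_reals all_analysis.

Set Implicit Arguments.
Unset Strict Implicit.
Unset Printing Implicit Defensive.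

Import Order.TTheory GRing.Theory Num.Theory.

Local Open Scope ring_scope.
Local Open Scope classical_set_scope.

(* A simple graph on the vertex type [T] is a symmetric irreflexive [e : rel T];
   its edges are unordered pairs, so that [#|edges e|] counts each edge once. *)
Definition edges (T : finType) (e : rel T) : {set {set T}} :=
  [set [set p.1; p.2] | p : T * T & e p.1 p.2]%SET.

(* [m]^3 with [m] = {0, ..., m-1}, and its inclusion into R^3. *)
Definition grid (m : nat) := 'rV['I_m]_3.

Definition grid_point (R : realType) (m : nat) (a : grid m) : 'rV[R]_3 :=
  \row_j (nat_of_ord (a ord0 j))%:R.

Definition segment (R : realType) (p q : 'rV[R]_3) : set 'rV[R]_3 :=
  [set (1 - t) *: p + t *: q | t in `[0, 1]].

(* The interior is relative to the segment: the endpoints are removed. *)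
Definition segment_interior (R : realType) (p q : 'rV[R]_3) : set 'rV[R]_3 :=
  [set (1 - t) *: p + t *: q | t in `]0, 1[].

Definition grid_drawing (R : realType) (T : finType) (e : rel T) (m : nat)
    (f : T -> grid m) : Prop :=
  let pt v := grid_point R (f v) in
  [/\ injective f,
      forall u v w : T, e u v -> w != u -> w != v ->
        ~ segment (pt u) (pt v) (pt w)
    & forall u v u' v' : T, e u v -> e u' v' ->
        [set u; v]%SET != [set u'; v']%SET ->
        segment_interior (pt u) (pt v) `&` segment_interior (pt u') (pt v')
        = set0].

(* Main.v *)
(* Place the vertices by a uniformly random permutation of the N = m^3 grid
   points and use a union bound.  A drawing is correct as soon as no edge is
   collinear with a third vertex and no two disjoint edges are coplanar.
   At most O(m^6) triples of grid points are collinear: through a given point,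
   the line with primitive direction of sup norm r contains O(m / r) grid points,
   and there are O(r^2) such directions.  At most O(m^9 log m) quadruples are
   coplanar but not collinear: a plane spanned by grid points, with primitive
   normal of sup norm r < 2 m^2, contains O(m^2 / r) of them, and summing
   (m^2 / r)^3 over the O(r^2) normals of norm r and over r gives the logarithm.
   So for n vertices and k edges the expected number of bad events is
   O(n k / m^3 + k^2 log m / m^3). *)

Require Import Defs.
From mathcomp Require Import all_boot all_order all_algebra.
From mathcomp Require Import unstable fingroup perm action primitive_action alt.
From mathcomp Require Import all_classical all_reals all_analysis.
From mathcomp Require Import ring lra zify.

Set Implicit Arguments.
Unset Strict Implicit.
Unset Printing Implicit Defensive.

Import Order.TTheory GRing.Theory Num.Theory.

Local Open Scope ring_scope.

(** * Images of a fixed tuple under all permutations *)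

(** The symmetric group is transitive on duplicate-free [r]-tuples, so the sets of permutations
    sending [s] to a given such tuple are cosets of one another and have a common size. Taking all
    duplicate-free tuples as targets exhausts the permutations and determines this size. *)
Lemma card_perm_map_tuple (G : finType) (r : nat) (s : r.-tuple G)
    (B : {set r.-tuple G}) :
  uniq s -> (forall b, b \in B -> uniq b) ->
  (#|[set g : {perm G} | map_tuple g s \in B]| * #|G| ^_ r = #|B| * (#|G|)`!)%N.
Proof.
move=> us uB.
pose F b := [set g : {perm G} | map_tuple g s == b].
have rG : (r <= #|G|)%N by rewrite -(card_uniq_tuple us) max_card.
have uF (b : r.-tuple G) : uniq b -> b \in r.-dtuple([set: G])%g.
  by move=> ub; rewrite inE ub /=; apply/fintype.subsetP => x; rewrite inE.
have cF (b b' : r.-tuple G) : uniq b -> uniq b' -> #|F b| = #|F b'|.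
  move=> /uF ub /uF ub'.
  have tr := ntransitive_weak rG (Sym_trans G).
  have [p _ /(congr1 (@tval _ _)) /= pb] := atransP2 tr ub ub'.
  rewrite -(card_rcoset (F b) p); apply: eq_card => g; rewrite !inE mem_rcoset !inE.
  rewrite -!val_eqE /= pb; apply/eqP/eqP => [<-|E].
    rewrite -map_comp; apply: eq_map => x /=.
    by rewrite /aperm permM permKV.
  have -> : [seq (g * p^-1)%g x | x <- s] = [seq (p^-1)%g x | x <- [seq g x | x <- s]].
    by rewrite -map_comp; apply: eq_map => x /=; rewrite permM.
  rewrite E -map_comp -[RHS]map_id; apply: eq_map => x /=.
  by rewrite /aperm permK.
have cB (A : {set r.-tuple G}) : (forall b, b \in A -> uniq b) ->
    (#|[set g : {perm G} | map_tuple g s \in A]| = #|A| * #|F s|)%N.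
  move=> uA; rewrite -sum1_card.
  rewrite (partition_big (fun g : {perm G} => map_tuple g s) (mem A)) /=; last first.
    by move=> g; rewrite inE.
  rewrite -sum_nat_const; apply: eq_bigr => b bA.
  rewrite (cF s b us (uA b bA)) -sum1_card; apply: eq_bigl => g.
  by rewrite !inE andb_idl // => /eqP ->.
rewrite cB // -mulnA; congr (_ * _)%N.
pose U := [set b : r.-tuple G | uniq b].
have -> : (#|G| ^_ r = #|U|)%N.
  rewrite -cardsT -(card_uniq_tuples r (mem [set: G])); apply: eq_card => b.
  rewrite !inE andb_idl // => _; apply/allP => x; by rewrite inE.
rewrite mulnC -cB => [|b]; last by rewrite inE.
rewrite -cardsT -card_perm; apply: eq_card => g.
rewrite !inE map_inj_uniq ?us; last exact: perm_inj.
by apply/esym/fintype.subsetP => x _; rewrite inE.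
Qed.

(** * Integer vectors in dimension three *)

Definition gdiff m (a b : grid m) (j : 'I_3) : int :=
  (b ord0 j : nat)%:Z - (a ord0 j : nat)%:Z.

(** Indices in ['I_3] are added modulo 3, so any coordinate [i] can serve as the distinguished
    one. *)
Definition cross (S : comPzRingType) (x y : 'I_3 -> S) (i : 'I_3) : S :=
  x (i + 1) * y (i + 2) - x (i + 2) * y (i + 1).

Definition dot (S : comPzRingType) (x y : 'I_3 -> S) : S := \sum_j x j * y j.

Lemma ord3_cases (i j : 'I_3) : [\/ j = i, j = i + 1 | j = i + 2].
Proof.
case: i j => -[|[|[|//]]] ? [[|[|[|//]]] ?];
  by [apply: Or31; apply: val_inj | apply: Or32; apply: val_inj
     | apply: Or33; apply: val_inj].
Qed.

Lemma sum_ord3 (V : nmodType) (i : 'I_3) (F : 'I_3 -> V) :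
  \sum_j F j = F i + F (i + 1) + F (i + 2).
Proof.
have u : uniq [:: i; i + 1; i + 2] by case: i => -[|[|[|//]]].
transitivity (\sum_(j <- [:: i; i + 1; i + 2]) F j).
  rewrite [RHS]big_uniq //; apply: eq_bigl => j /=.
  by rewrite !inE; case: (ord3_cases i j) => ->; rewrite eqxx ?orbT.
by rewrite !big_cons big_nil addr0 addrA.
Qed.

Lemma dot_crossl (S : comPzRingType) (x y : 'I_3 -> S) : dot (cross x y) x = 0.
Proof.
rewrite /dot (sum_ord3 0) /cross !add0r.
have -> : 1 + 1 = 2 :> 'I_3 by apply: val_inj.
have -> : 1 + 2 = 0 :> 'I_3 by apply: val_inj.
have -> : 2 + 1 = 0 :> 'I_3 by apply: val_inj.
have -> : 2 + 2 = 1 :> 'I_3 by apply: val_inj.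
ring.
Qed.

Lemma dot_crossr (S : comPzRingType) (x y : 'I_3 -> S) : dot (cross x y) y = 0.
Proof.
rewrite /dot (sum_ord3 0) /cross !add0r.
have -> : 1 + 1 = 2 :> 'I_3 by apply: val_inj.
have -> : 1 + 2 = 0 :> 'I_3 by apply: val_inj.
have -> : 2 + 1 = 0 :> 'I_3 by apply: val_inj.
have -> : 2 + 2 = 1 :> 'I_3 by apply: val_inj.
ring.
Qed.

Lemma cross_eq0 (S : comPzRingType) (x y : 'I_3 -> S) :
  (forall i, cross x y i = 0) -> forall i j, x i * y j = x j * y i.
Proof.
move=> c i j; case: (ord3_cases i j) => -> //.
  have E1 : i + 2 + 1 = i by case: i => -[|[|[|//]]] ?; apply: val_inj.
  have E2 : i + 2 + 2 = i + 1 by case: i {E1} => -[|[|[|//]]] ?; apply: val_inj.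
  by move: (c (i + 2)); rewrite /cross E1 E2 => /eqP; rewrite subr_eq0 => /eqP.
have E1 : i + 1 + 1 = i + 2 by case: i => -[|[|[|//]]] ?; apply: val_inj.
have E2 : i + 1 + 2 = i by case: i {E1} => -[|[|[|//]]] ?; apply: val_inj.
by move: (c (i + 1)); rewrite /cross E1 E2 => /eqP; rewrite subr_eq0 => /eqP <-.
Qed.

(** By Bezout, the coordinates have gcd 1. The witness [w] later yields integer quotients along a
    line and coset representatives in a plane. *)
Definition primitive (v : 'I_3 -> int) := exists w, dot w v = 1.

(** Divide by the gcd, let [i] be a coordinate of largest absolute value, and multiply by its
    sign. *)
Lemma primitive_part (x : 'I_3 -> int) (j0 : 'I_3) : x j0 != 0 ->
  exists (g : int) (v : 'I_3 -> int) (i : 'I_3),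
    [/\ forall j, x j = g * v j, 0 < v i, forall j, `|v j| <= v i & primitive v].
Proof.
move=> xj0.
pose h := gcdz (x 0) (x 1); pose g := gcdz h (x 2).
have gx j : (g %| x j)%Z.
  have gh : (g %| h)%Z by rewrite dvdz_gcdl.
  case: (ord3_cases 0 j) => ->; rewrite ?add0r.
  - by apply: dvdz_trans gh _; rewrite dvdz_gcdl.
  - by apply: dvdz_trans gh _; rewrite dvdz_gcdr.
  - by rewrite dvdz_gcdr.
have g0 : g != 0.
  by apply: contra_neq xj0 => g0; apply/eqP; move: (gx j0); rewrite g0 dvd0z.
pose v0 j := (x j %/ g)%Z.
have xE j : x j = g * v0 j by rewrite mulrC divzK.
have [w0 w0E] : primitive v0.
  have [u [v /= uvE]] := Bezoutz (x 0) (x 1).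
  have [u' [v' /= uvE']] := Bezoutz h (x 2).
  (* Bezout for [x 0] and [x 1] is substituted into Bezout for their gcd [h] and [x 2]. *)
  exists (fun j => if j == 0 then u' * u else if j == 1 then u' * v else v').
  apply: (mulfI g0); rewrite mulr1 -[RHS]uvE' /h -uvE /dot (sum_ord3 0) /= !add0r.
  rewrite (xE 0) (xE 1) (xE 2); ring.
case: (@arg_maxnP 'I_3 0 predT (fun j => absz (v0 j))) => // i _ imax.
have le0 j : `|v0 j| <= `|v0 i| by have := imax j isT; lia.
have vi0 : v0 i != 0.
  apply: contra_neq xj0 => vi0; rewrite xE.
  by move: (le0 j0); rewrite vi0 normr0 normr_le0 => /eqP ->; rewrite mulr0.
exists (g * sgz (v0 i)), (fun j => sgz (v0 i) * v0 j), i.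
have s2 : sgz (v0 i) * sgz (v0 i) = 1 by rewrite mulz_sg vi0.
split=> [j||j|].
- by rewrite xE mulrA -(mulrA g) s2 mulr1.
- by rewrite -normrEsg normr_gt0.
- rewrite -[leRHS]normrEsg normrM; apply: le_trans (le0 j).
  by rewrite normr_sgz vi0 mul1r.
- exists (fun j => sgz (v0 i) * w0 j).
  rewrite -w0E; apply: eq_bigr => j _.
  by rewrite mulrACA s2 mul1r.
Qed.

(** * Packing of grid points on lines and planes *)

Lemma normz_mul_small (k r : int) : `|k * r| < r -> k = 0.
Proof.
move=> h; apply: contraTeq h => k0; rewrite -leNgt normrM.
have r_le : r <= `|r| by rewrite ler_norm.
by apply: (le_trans r_le); rewrite ler_peMl //; lia.
Qed.

Lemma gdiff_inj m (a b b' : grid m) : gdiff a b =1 gdiff a b' -> b = b'.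
Proof.
move=> E; apply/rowP => j; apply: val_inj; move: (E j).
by rewrite /gdiff => /addIr [].
Qed.

Lemma gdiff_bound m (a b : grid m) j : `|gdiff a b j| < m%:Z.
Proof.
rewrite /gdiff; have := ltn_ord (a ord0 j); have := ltn_ord (b ord0 j); lia.
Qed.

(** The [i]-th coordinates of the points of [P] are congruent modulo [r] and determine the points,
    so adding [0, ..., r - 1] to them gives distinct integers below [m + r]. *)
Lemma line_packing m (a : grid m) (v : 'I_3 -> int) (i : 'I_3) (r : nat)
    (P : {set grid m}) : v i = r%:Z -> (0 < r)%N ->
  (forall b, b \in P -> exists t : int, forall j, gdiff a b j = t * v j) ->
  (#|P| * r <= m + r)%N.
Proof.
move=> vi r0 PP.
have lt (q : grid m * 'I_r) : (q.1 ord0 i + q.2 < m + r)%N.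
  by have := ltn_ord (q.1 ord0 i); have := ltn_ord q.2; lia.
have -> : (#|P| * r)%N = #|finset.setX P [set: 'I_r]| by rewrite cardsX cardsT card_ord.
rewrite -(@card_in_imset _ _ (fun q => Ordinal (lt q))) => [|[p s] [p' s']].
  by rewrite -[leqRHS]card_ord max_card.
rewrite !inE !andbT /= => /PP [t Et] /PP [t' Et'] [E].
have tt : t = t'.
  have := Et i; have := Et' i; rewrite vi /gdiff => e1 e2.
  have : (t - t') * r%:Z = (s' : nat)%:Z - (s : nat)%:Z.
    by rewrite mulrBl -e1 -e2; move: E; clear; lia.
  have := ltn_ord s; have := ltn_ord s' => l1 l2 e.
  by apply/eqP; rewrite -subr_eq0; apply/eqP/(@normz_mul_small _ r%:Z); lia.
have E1 : p = p' by apply: (@gdiff_inj _ a) => j; rewrite Et Et' tt.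
by congr pair => //; apply: val_inj => /=; move: E; rewrite E1; lia.
Qed.

(* A full set of representatives of Z^2 modulo the lattice spanned by [u] and
   [w] lies in their fundamental parallelogram. *)
Lemma parallelogram_reduction (M : int) (u1 u2 w1 w2 Z1 Z2 : int) :
  `|u1| <= M -> `|u2| <= M -> `|w1| <= M -> `|w2| <= M ->
  u1 * w2 - u2 * w1 != 0 ->
  exists q q' : int, `|Z1 - q * u1 - q' * w1| <= 2 * M /\
                     `|Z2 - q * u2 - q' * w2| <= 2 * M.
Proof.
move=> bu1 bu2 bw1 bw2; set D := _ - _ => D0.
pose e := Z1 * w2 - Z2 * w1; pose e' := u1 * Z2 - u2 * Z1.
have bound (x y : int) z : `|x| <= M -> `|y| <= M ->
    D * z = (e %% D)%Z * x + (e' %% D)%Z * y -> `|z| <= 2 * M.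
  move=> bx by_ E; have D1 : 0 < `|D| by rewrite normr_gt0.
  rewrite -(ler_pM2l D1) -normrM E.
  have := modz_ge0 e D0; have := modz_ge0 e' D0.
  have := ltz_mod e D0; have := ltz_mod e' D0.
  move=> l1 l2 l3 l4.
  apply: (le_trans (ler_normD _ _)); rewrite !normrM.
  have -> : `|D| * (2 * M) = `|D| * M + `|D| * M by ring.
  by apply: lerD; apply: ler_pM => //; rewrite ger0_norm // ltW.
have eq1 := divz_eq e D; have eq2 := divz_eq e' D.
exists (e %/ D)%Z, (e' %/ D)%Z; split.
- apply: (bound u1 w1) => //.
  have -> : (e %% D)%Z = e - (e %/ D)%Z * D by rewrite {2}eq1; ring.
  have -> : (e' %% D)%Z = e' - (e' %/ D)%Z * D by rewrite {2}eq2; ring.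
  set q := (e %/ D)%Z; set q' := (e' %/ D)%Z; rewrite /e /e' /D; ring.
- apply: (bound u2 w2) => //.
  have -> : (e %% D)%Z = e - (e %/ D)%Z * D by rewrite {2}eq1; ring.
  have -> : (e' %% D)%Z = e' - (e' %/ D)%Z * D by rewrite {2}eq2; ring.
  set q := (e %/ D)%Z; set q' := (e' %/ D)%Z; rewrite /e /e' /D; ring.
Qed.

(* The points of [P] project to a planar lattice of index [r]; translating them
   by representatives of its [r] cosets yields distinct points of a box. *)
Lemma plane_packing m (a b c : grid m) (v : 'I_3 -> int) (i : 'I_3) (r : nat)
    (P : {set grid m}) : v i = r%:Z -> (0 < r)%N -> primitive v ->
  (forall p, p \in P -> dot v (gdiff a p) = 0) ->
  b \in P -> c \in P -> cross (gdiff a b) (gdiff a c) i != 0 ->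
  (#|P| * r <= 25 * m ^ 2)%N.
Proof.
move=> vi r0 [w]; rewrite /dot (sum_ord3 i) vi => wv PP bP cP D0.
have {}PP p : p \in P -> r%:Z * gdiff a p i
    + v (i + 1) * gdiff a p (i + 1) + v (i + 2) * gdiff a p (i + 2) = 0.
  by move=> /PP; rewrite /dot (sum_ord3 i) vi.
(* Coordinates [i + 1] and [i + 2] of [v] define a functional whose value at [t * w] is congruent to
   [t] modulo [r], and whose values at the projections of [gdiff a b] and [gdiff a c] are multiples
   of [r]. Reducing [t * w] by these two vectors keeps the residue and bounds the size. *)
have /choice [F HF] : forall t : 'I_r, exists z : int * int * int,
  [/\ `|z.1.1| <= 2 * m%:Z, `|z.1.2| <= 2 * m%:Z
    & v (i + 1) * z.1.1 + v (i + 2) * z.1.2 = (t : nat)%:Z + r%:Z * z.2].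
  move=> t; pose Z j := (t : nat)%:Z * w j.
  have [q [q' [h1 h2]]] := @parallelogram_reduction m%:Z _ _ _ _ (Z (i + 1)) (Z (i + 2))
     (ltW (gdiff_bound a b (i + 1))) (ltW (gdiff_bound a b (i + 2)))
     (ltW (gdiff_bound a c (i + 1))) (ltW (gdiff_bound a c (i + 2))) D0.
  eexists (_, _, - ((t : nat)%:Z * w i) + q * gdiff a b i + q' * gdiff a c i).
  split; [exact: h1|exact: h2|] => /=.
  move: (PP _ bP) (PP _ cP) => e1 e2.
  apply/eqP; rewrite -subr_eq0; apply/eqP.
  transitivity ((t : nat)%:Z * (w i * r%:Z + w (i + 1) * v (i + 1) + w (i + 2) * v (i + 2) - 1)
    - q * (r%:Z * gdiff a b i + v (i + 1) * gdiff a b (i + 1) + v (i + 2) * gdiff a b (i + 2))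
    - q' * (r%:Z * gdiff a c i + v (i + 1) * gdiff a c (i + 1) + v (i + 2) * gdiff a c (i + 2))).
    rewrite /Z; ring.
  have -> : w i * r%:Z + w (i + 1) * v (i + 1) + w (i + 2) * v (i + 2) = 1.
    by rewrite -wv; ring.
  by rewrite e1 e2 subrr !mulr0 !subr0.
(* A coordinate in [[0, m)] plus a shift in [[-2m, 2m]] plus [2m] lies in [[0, 5m)]; two coordinates
   give [25 * m ^ 2]. *)
have lt1 (s : grid m * 'I_r) :
    (absz ((s.1 ord0 (i + 1) : nat)%:Z + (F s.2).1.1 + 2 * m%:Z)%R < 5 * m)%N.
  have [h _ _] := HF s.2; have := ltn_ord (s.1 ord0 (i + 1)); lia.
have lt2 (s : grid m * 'I_r) :
    (absz ((s.1 ord0 (i + 2) : nat)%:Z + (F s.2).1.2 + 2 * m%:Z)%R < 5 * m)%N.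
  have [_ h _] := HF s.2; have := ltn_ord (s.1 ord0 (i + 2)); lia.
have shift_inj (x x' : nat) (z z' M : int) : `|z| <= M -> `|z'| <= M ->
    absz (x%:Z + z + M) = absz (x'%:Z + z' + M) -> x%:Z + z = x'%:Z + z'.
  by clear; lia.
have -> : (#|P| * r)%N = #|finset.setX P [set: 'I_r]| by rewrite cardsX cardsT card_ord.
rewrite -(@card_in_imset _ _ (fun s => (Ordinal (lt1 s), Ordinal (lt2 s)))) => [|[p s] [p' s']].
  apply: (leq_trans (max_card _)).
  by rewrite card_prod !card_ord; lia.
rewrite !inE !andbT /= => /PP Es /PP Es' [E1 E2].
have [b1 b2 Fs] := HF s; have [b1' b2' Fs'] := HF s'.
have {}E1 : (p ord0 (i + 1) : nat)%:Z + (F s).1.1 =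
     (p' ord0 (i + 1) : nat)%:Z + (F s').1.1.
  exact: shift_inj b1 b1' E1.
have {}E2 : (p ord0 (i + 2) : nat)%:Z + (F s).1.2 =
     (p' ord0 (i + 2) : nat)%:Z + (F s').1.2.
  exact: shift_inj b2 b2' E2.
(* The functional at the two equal translates shows that [s] and [s'] are congruent modulo [r], and
   both are below [r]. *)
have tt : s = s'.
  have : (s : nat)%:Z - (s' : nat)%:Z = r%:Z *
     (gdiff a p i - gdiff a p' i + (F s').2 - (F s).2).
    have -> : (s : nat)%:Z = v (i + 1) * (F s).1.1 + v (i + 2) * (F s).1.2
      - r%:Z * (F s).2 by rewrite Fs; ring.
    have -> : (s' : nat)%:Z = v (i + 1) * (F s').1.1 + v (i + 2) * (F s').1.2
      - r%:Z * (F s').2 by rewrite Fs'; ring.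
    have -> : (F s).1.1 = (p' ord0 (i + 1) : nat)%:Z + (F s').1.1
       - (p ord0 (i + 1) : nat)%:Z by rewrite -E1; ring.
    have -> : (F s).1.2 = (p' ord0 (i + 2) : nat)%:Z + (F s').1.2
       - (p ord0 (i + 2) : nat)%:Z by rewrite -E2; ring.
    have eE : r%:Z * gdiff a p i =
        - v (i + 1) * gdiff a p (i + 1) - v (i + 2) * gdiff a p (i + 2).
      by apply/eqP; rewrite -subr_eq0; apply/eqP; rewrite -Es; ring.
    have eE' : r%:Z * gdiff a p' i =
        - v (i + 1) * gdiff a p' (i + 1) - v (i + 2) * gdiff a p' (i + 2).
      by apply/eqP; rewrite -subr_eq0; apply/eqP; rewrite -Es'; ring.
    have -> : forall x x' y y' : int,
        r%:Z * (x - x' + y - y') = r%:Z * x - r%:Z * x' + r%:Z * (y - y').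
      by move=> *; ring.
    by rewrite eE eE' /gdiff; ring.
  move=> e; apply: val_inj => /=.
  have := ltn_ord s; have := ltn_ord s'; move: e; set k := (X in _ * X).
  rewrite mulrC => e l1 l2; have k0 : k = 0 by apply: (@normz_mul_small _ r%:Z); lia.
  by move: e; rewrite k0 mul0r; lia.
have F1 : gdiff a p (i + 1) = gdiff a p' (i + 1).
  by rewrite /gdiff; move: E1; rewrite tt => /addIr ->.
have F2 : gdiff a p (i + 2) = gdiff a p' (i + 2).
  by rewrite /gdiff; move: E2; rewrite tt => /addIr ->.
(* The equation of the plane recovers coordinate [i] from the other two, its coefficient [r] being
   nonzero. *)
congr pair => //; apply: (@gdiff_inj _ a) => j; case: (ord3_cases i j) => -> //.
move: Es Es'; rewrite F1 F2 => Es Es'.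
have r0' : r%:Z != 0 by lia.
apply: (mulfI r0').
by move: Es; rewrite -Es' => /addIr /addIr.
Qed.

(** * Counting collinear triples and coplanar quadruples *)

Lemma card_dep_pairs (A B : finType) (F : A -> {set B}) (n : nat) :
  (forall a, (#|F a| <= n)%N) ->
  (#|[set q : A * B | q.2 \in F q.1]| <= #|A| * n)%N.
Proof.
move=> Fn; rewrite -sum1_card -sum_nat_const.
have -> : (\sum_(q in [set q : A * B | q.2 \in F q.1]) 1 =
    \sum_(a in A) \sum_(b in F a) 1)%N.
  by rewrite pair_big_dep; apply: eq_bigl => q; rewrite !inE.
by apply: leq_sum => a _; rewrite sum1_card.
Qed.

(** Each dyadic block from [2 ^ t] to [2 ^ t.+1] has [2 ^ t] terms of size at most [X %/ 2 ^ t],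
    hence contributes at most [X]. The term at [r = 0] is zero by the convention on division by
    zero. *)
Lemma sum_divn_le (X t : nat) : (\sum_(r < 2 ^ t) X %/ r <= X * t)%N.
Proof.
elim: t => [|t IH]; first by rewrite expn0 big_ord_recl big_ord0.
rewrite -(big_mkord xpredT (fun r => X %/ r)%N) in IH.
rewrite -(big_mkord xpredT (fun r => X %/ r)%N).
rewrite (big_cat_nat (n := 2 ^ t)%N) ?leq_exp2l //= mulnS addnC leq_add //.
apply: leq_trans (_ : \sum_(2 ^ t <= r < 2 ^ t.+1) X %/ 2 ^ t <= _)%N.
  rewrite big_nat [leqRHS]big_nat; apply: leq_sum => r /andP[r1 _].
  by apply: leq_div2l => //; rewrite expn_gt0.
by rewrite sum_nat_const_nat expnS mul2n -addnn addnK mulnC leq_divM.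
Qed.

(* Up to sign, an integer vector of sup norm [r] has a coordinate equal to [r],
   say the [i]-th one, and is encoded by its other two coordinates. *)
Definition box_vector (i : 'I_3) (r : nat) (p : 'I_(2 * r + 1) * 'I_(2 * r + 1))
    (j : 'I_3) : int :=
  if j == i then r%:Z
  else if j == i + 1 then (p.1 : nat)%:Z - r%:Z else (p.2 : nat)%:Z - r%:Z.

Lemma box_vectorP (v : 'I_3 -> int) (i : 'I_3) (r : nat) :
  v i = r%:Z -> (forall j, `|v j| <= r%:Z) -> exists p, v = @box_vector i r p.
Proof.
move=> vi vr.
have lt j : (absz (v j + r%:Z)%R < 2 * r + 1)%N by have := vr j; lia.
exists (Ordinal (lt (i + 1)), Ordinal (lt (i + 2))); apply/funext => j.
rewrite /box_vector /=; case: (ord3_cases i j) => ->.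
- by rewrite eqxx.
- rewrite eqxx; have -> : (i + 1 == i) = false by case: i {vi} => -[|[|[|//]]].
  by have := vr (i + 1); lia.
- have -> : (i + 2 == i) = false by case: i {vi} => -[|[|[|//]]].
  have -> : (i + 2 == i + 1) = false by case: i {vi} => -[|[|[|//]]].
  by have := vr (i + 2); lia.
Qed.

(** Union bound over the codes: for each [i] and [r] there are [(2 * r + 1) ^ 2] of them,
    contributing at most [K r] together. *)
Lemma card_box_vector_cover (T : finType) (M : nat) (K : nat -> nat)
    (W : forall (i : 'I_3) (r : nat), 'I_(2 * r + 1) * 'I_(2 * r + 1) -> {set T})
    (A : {set T}) :
  (forall i r p, (r < M -> #|W i r p| * (2 * r + 1) ^ 2 <= K r)%N) ->
  (forall x, x \in A -> exists i r p, (r < M)%N /\ x \in W i r p) ->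
  (#|A| <= 3 * \sum_(r < M) K r)%N.
Proof.
move=> WK AW.
apply: (@leq_trans #|\bigcup_i \bigcup_(r < M) \bigcup_p W i r p|%SET).
  apply: subset_leq_card; apply/fintype.subsetP => x /AW [i [r [p [rM xW]]]].
  apply/finset.bigcupP; exists i => //.
  apply/finset.bigcupP; exists (Ordinal rM) => //.
  by apply/finset.bigcupP; exists p.
apply: leq_trans (card_big_setU _ _ _) _.
rewrite -[in leqRHS](card_ord 3) -sum_nat_const; apply: leq_sum => i _.
apply: leq_trans (card_big_setU _ _ _) _; apply: leq_sum => r _.
apply: leq_trans (card_big_setU _ _ _) _.
have c0 : (0 < (2 * r + 1) ^ 2)%N by rewrite expn_gt0 addn1.
rewrite -(leq_pmul2r c0) big_distrl /=.
apply: (@leq_trans (\sum_(p : 'I_(2 * r + 1) * 'I_(2 * r + 1)) K r)%N).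
  by apply: leq_sum => p _; apply: WK.
by rewrite sum_nat_const card_prod !card_ord mulnC mulnn.
Qed.

Definition collinear m (a b c : grid m) : bool :=
  [forall i, cross (gdiff a b) (gdiff a c) i == 0].

(** The scalar triple product. It vanishes for every [d] once [a], [b], [c] are collinear, so such
    triples are counted apart. *)
Definition coplanar m (a b c d : grid m) : bool :=
  dot (cross (gdiff a b) (gdiff a c)) (gdiff a d) == 0.

Lemma card_grid m : #|{: grid m}| = (m ^ 3)%N.
Proof. by rewrite card_mx card_ord. Qed.

(** The vector is the primitive part of [gdiff a b], which is a nonzero integer multiple of it;
    hence [r < m]. *)
Lemma collinear_cover m (a b c : grid m) : b != a -> collinear a b c ->
  exists i (r : nat) p, [/\ (0 < r < m)%N,
    exists t : int, forall j, gdiff a b j = t * @box_vector i r p j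
  & exists t : int, forall j, gdiff a c j = t * @box_vector i r p j].
Proof.
move=> ba /forallP/= col.
have col0 i : cross (gdiff a b) (gdiff a c) i = 0 by apply/eqP/col.
have [j0 bj0] : exists j, gdiff a b j != 0.
  apply/existsP; rewrite -negb_forall; apply: contra ba => /forallP h.
  by apply/eqP/(@gdiff_inj _ a) => j; rewrite (eqP (h j)) /gdiff subrr.
have [g [v [i [bE vi vle [w wv]]]]] := primitive_part bj0.
have g0 : g != 0 by apply: contra_neq bj0 => g0; rewrite bE g0 mul0r.
pose r := absz (v i).
have vr : v i = r%:Z by rewrite /r; lia.
have [p vp] : exists p, v = @box_vector i r p.
  by apply: box_vectorP => // j; rewrite -vr.
exists i, r, p; split; last first.
- have vc j k : v j * gdiff a c k = v k * gdiff a c j.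
    by apply: (mulfI g0); rewrite !mulrA -!bE (cross_eq0 col0).
  (* The quotient is sum_k w_k c_k, since w . v = 1 *)
  exists (dot w (gdiff a c)) => j.
  rewrite -vp -[LHS]mul1r -wv /dot !mulr_suml; apply: eq_bigr => k _.
  by rewrite -!mulrA [gdiff a c k * _]mulrC vc.
- by exists g => j; rewrite -vp.
have := gdiff_bound a b i; rewrite bE normrM => lt.
have g1 : 1 <= `|g| by rewrite -gtz0_ge1 normr_gt0.
have : `|v i| <= `|g| * `|v i| by rewrite ler_peMl.
lia.
Qed.

(** If a line of norm [r] through [a] has [l] points, then [l * r <= 2 * m]. With
    [2 * r + 1 <= 3 * r], all lines with given [i] and [r] carry at most [9 * (2 * m) ^ 2] pairs;
    summing over three [i] and over [r < m] gives [108 * m ^ 3]. *)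
Lemma card_collinear m :
  (#|[set q : grid m * (grid m * grid m) |
       (q.2.1 != q.1) && collinear q.1 q.2.1 q.2.2]| <= m ^ 3 * (108 * m ^ 3))%N.
Proof.
pose F (a : grid m) := [set q : grid m * grid m | (q.1 != a) && collinear a q.1 q.2].
rewrite -{1}card_grid.
have -> : [set q : grid m * (grid m * grid m) | (q.2.1 != q.1) && collinear q.1 q.2.1 q.2.2]
    = [set q | q.2 \in F q.1] by apply/setP => q; rewrite !inE.
apply: card_dep_pairs => a.
pose L i r p : {set grid m} := [set b | (0 < r)%N &&
  `[< exists t : int, forall j, gdiff a b j = t * @box_vector i r p j >]].
have -> : (108 * m ^ 3 = 3 * \sum_(r < m) 36 * m ^ 2)%N.
  by rewrite sum_nat_const card_ord; lia.
apply: (@card_box_vector_cover _ m (fun _ => 36 * m ^ 2)%N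
  (fun i r p => finset.setX (L i r p) (L i r p))).
  move=> i r p rm; case: (posnP r) => [r0|r0].
    have -> : L i r p = finset.set0.
      by apply/setP => b; rewrite !inE; apply/negbTE/nandP; left; lia.
    by rewrite cardsX cards0.
  have : (#|L i r p| * r <= m + r)%N.
    apply: (@line_packing m a (@box_vector i r p) i) => //.
      by rewrite /box_vector eqxx.
    by move=> b; rewrite inE => /andP[_ /asboolP].
  rewrite cardsX; move: #|_| => l lr.
  have h1 : (l * r <= 2 * m)%N by lia.
  have h2 : ((l * r) ^ 2 <= (2 * m) ^ 2)%N by rewrite leq_exp2r.
  have h3 : ((2 * r + 1) ^ 2 <= (3 * r) ^ 2)%N by rewrite leq_exp2r //; lia.
  apply: (@leq_trans (l * l * (3 * r) ^ 2)); first by rewrite leq_mul2l h3 orbT.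
  by move: h2; rewrite !expnMn; lia.
move=> [b c]; rewrite inE /= => /andP[ba col].
have [i [r [p [/andP[r0 rm] tb tc]]]] := collinear_cover ba col.
exists i, r, p; split => //; rewrite !inE r0 /=.
by apply/andP; split; apply/asboolP.
Qed.

(** The normal is the primitive part of the cross product, each coordinate of which is a difference
    of two products of integers below [m] in absolute value. *)
Lemma coplanar_cover m (a b c d : grid m) :
  ~~ collinear a b c -> coplanar a b c d ->
  exists i (r : nat) p, [/\ (0 < r < 2 * m ^ 2)%N, primitive (@box_vector i r p),
    cross (gdiff a b) (gdiff a c) i != 0
  & forall q, q \in [:: b; c; d] -> dot (@box_vector i r p) (gdiff a q) = 0].
Proof.
rewrite negb_forall => /existsP/= [j0 cr0] /eqP cop.
have [g [v [i [bE vi vle vprim]]]] := primitive_part cr0.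
have g0 : g != 0 by apply: contra_neq cr0 => g0; rewrite bE g0 mul0r.
pose r := absz (v i).
have vr : v i = r%:Z by rewrite /r; lia.
have [p vp] : exists p, v = @box_vector i r p.
  by apply: box_vectorP => // j; rewrite -vr.
have cri : cross (gdiff a b) (gdiff a c) i != 0 by rewrite bE mulf_neq0 // gt_eqF.
have dE q : dot (cross (gdiff a b) (gdiff a c)) (gdiff a q) = g * dot v (gdiff a q).
  by rewrite /dot mulr_sumr; apply: eq_bigr => j _; rewrite bE mulrA.
exists i, r, p; rewrite -vp; split => //; last first.
  move=> q; rewrite !inE => qbcd; apply: (mulfI g0); rewrite mulr0 -dE.
  by case/or3P: qbcd => /eqP -> //; [exact: dot_crossl|exact: dot_crossr].
have : `|cross (gdiff a b) (gdiff a c) i| < 2 * m%:Z ^+ 2.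
  rewrite /cross; apply: le_lt_trans (ler_normB _ _) _; rewrite !normrM.
  have -> : 2 * m%:Z ^+ 2 = m%:Z * m%:Z + m%:Z * m%:Z by ring.
  by apply: ltrD; apply: ltr_pM => //; apply: gdiff_bound.
rewrite bE normrM => lt.
have g1 : 1 <= `|g| by rewrite -gtz0_ge1 normr_gt0.
have : `|v i| <= `|g| * `|v i| by rewrite ler_peMl.
move: lt; rewrite (_ : m%:Z ^+ 2 = (m ^ 2)%N%:Z) ?PoszM //; lia.
Qed.

(* 421875 = 3 * 9 * 25 ^ 3 *)
Lemma card_coplanar m (t : nat) : (2 * m ^ 2 <= 2 ^ t)%N ->
  (#|[set q : grid m * (grid m * grid m * grid m) |
       ~~ collinear q.1 q.2.1.1 q.2.1.2 && coplanar q.1 q.2.1.1 q.2.1.2 q.2.2]|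
   <= m ^ 3 * (421875 * m ^ 6 * t))%N.
Proof.
move=> mt.
pose F (a : grid m) := [set q : grid m * grid m * grid m |
  ~~ collinear a q.1.1 q.1.2 && coplanar a q.1.1 q.1.2 q.2].
rewrite -{1}card_grid.
have -> : [set q : grid m * (grid m * grid m * grid m) |
       ~~ collinear q.1 q.2.1.1 q.2.1.2 && coplanar q.1 q.2.1.1 q.2.1.2 q.2.2]
    = [set q | q.2 \in F q.1] by apply/setP => q; rewrite !inE.
apply: card_dep_pairs => a.
(* [good] collects what [plane_packing] needs. For other codes [P] is empty, so the bound below
   holds for all codes, including [r = 0], where [X %/ r] is zero. *)
pose good i r p := [&& (0 < r)%N, `[< primitive (@box_vector i r p) >]
  & `[< exists b c, [/\ cross (gdiff a b) (gdiff a c) i != 0,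
      dot (@box_vector i r p) (gdiff a b) = 0
    & dot (@box_vector i r p) (gdiff a c) = 0] >]].
pose P i r p : {set grid m} :=
  [set b | good i r p && (dot (@box_vector i r p) (gdiff a b) == 0)].
(* [140625 = 9 * 25 ^ 3], where 9 comes from [(2 * r + 1) ^ 2 <= 9 * r ^ 2]. Cubing the packing
   bound uses three factors [r] and only two are supplied, hence the quotient by [r]. *)
pose X := (140625 * m ^ 6)%N.
have bound i r p : (#|P i r p| ^ 3 * (2 * r + 1) ^ 2 <= X %/ r)%N.
  case: (boolP (good i r p)) => [gd|/negbTE gd]; last first.
    have -> : P i r p = finset.set0 by apply/setP => b; rewrite !inE gd.
    by rewrite cards0.
  case/and3P: (gd) => r0 /asboolP prim /asboolP [b [c [cr bP cP]]].
  have h1 : (#|P i r p| * r <= 25 * m ^ 2)%N.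
    apply: (@plane_packing m a b c (@box_vector i r p) i) => //.
    - by rewrite /box_vector eqxx.
    - by move=> q; rewrite inE => /andP[_ /eqP].
    - by rewrite inE gd bP eqxx.
    - by rewrite inE gd cP eqxx.
  rewrite leq_divRL //; move: h1; move: #|_| => l h1.
  have h2 : ((l * r) ^ 3 <= (25 * m ^ 2) ^ 3)%N by rewrite leq_exp2r.
  have h3 : ((2 * r + 1) ^ 2 <= (3 * r) ^ 2)%N by rewrite leq_exp2r //; lia.
  apply: (@leq_trans (l ^ 3 * (3 * r) ^ 2 * r)).
    by rewrite leq_mul2r leq_mul2l h3 !orbT.
  have -> : (l ^ 3 * (3 * r) ^ 2 * r = 9 * (l * r) ^ 3)%N by rewrite !expnMn; ring.
  apply: (@leq_trans (9 * (25 * m ^ 2) ^ 3)); first by rewrite leq_mul2l h2 orbT.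
  by rewrite /X expnMn -expnM mulnA.
apply: (@leq_trans (3 * \sum_(r < 2 ^ t) X %/ r)%N); last first.
  have -> : (421875 * m ^ 6 * t = 3 * (X * t))%N by rewrite /X; ring.
  by rewrite leq_mul2l sum_divn_le orbT.
apply: (@card_box_vector_cover _ (2 ^ t) (fun r => X %/ r)%N
   (fun i r p => finset.setX (finset.setX (P i r p) (P i r p)) (P i r p))).
  move=> i r p _; rewrite !cardsX; apply: leq_trans (bound i r p).
  by have -> // : forall l : nat, (l * l * l = l ^ 3)%N by move=> l; ring.
move=> [[b c] d]; rewrite inE /= => /andP[col cop].
have [i [r [p [/andP[r0 rm] prim cri bcd]]]] := coplanar_cover col cop.
have gd : good i r p.
  apply/and3P; split=> //; first by apply/asboolP.
  by apply/asboolP; exists b, c; split => //; apply: bcd; rewrite !inE eqxx ?orbT.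
exists i, r, p; split; first exact: leq_trans mt.
by rewrite !inE /= gd !bcd ?eqxx // !inE eqxx ?orbT.
Qed.

(** * Union bound over the vertices and edges *)

Lemma card_oriented_edges (T : finType) (e : rel T) :
  (#|[set p : T * T | e p.1 p.2]| <= 2 * #|edges e|)%N.
Proof.
rewrite -sum1_card.
rewrite (partition_big (fun p : T * T => [set p.1; p.2]%SET) (mem (edges e))) /=.
  rewrite mulnC -sum_nat_const; apply: leq_sum => S /imsetP [[u v] _ /= ->].
  rewrite sum1_card.
  apply: (@leq_trans #|[set (u, v); (v, u)]%SET|); last by rewrite cards2; case: (_ != _).
  apply: subset_leq_card; apply/fintype.subsetP => -[x y].
  rewrite unfold_in /= inE /= => /andP[_ /eqP E].
  have := finset.set21 x y; have := finset.set22 x y; rewrite E !inE => hy hx.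
  have := finset.set21 u v; have := finset.set22 u v; rewrite -E !inE => hv hu.
  rewrite !xpair_eqE; move: hx hy hu hv.
  rewrite [u == x]eq_sym [u == y]eq_sym [v == x]eq_sym [v == y]eq_sym.
  by case: (x == u); case: (x == v); case: (y == u); case: (y == v).
move=> p; rewrite inE => ep; by apply/imsetP; exists p => //; rewrite inE.
Qed.

(** This bound and the next pass from injective tuples to all tuples at the cost of a factor 2. *)
Lemma ffact3_ge N : (12 <= N)%N -> (N ^ 3 <= 2 * N ^_ 3)%N.
Proof. rewrite !ffactnS ffactn0 muln1 => N12; nia. Qed.

Lemma ffact4_ge N : (12 <= N)%N -> (N ^ 4 <= 2 * N ^_ 4)%N.
Proof.
move=> N12; rewrite !ffactnS ffactn0 muln1.
have -> : N = (N - 12 + 12)%N by lia.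
move: (N - 12)%N => M; rewrite !addnS addn0 /=; nia.
Qed.

(** A fixed injection is composed with a permutation [g]. A triple becomes collinear for at most a
    fraction [216 / m ^ 3] of the [g], and a quadruple becomes coplanar without its first three
    points being collinear for at most [843750 * t / m ^ 3]. For [n] vertices and [k] edges there
    are at most [2 * k * n] triples and [8 * k * (k - 1)] quadruples to avoid. *)
Lemma exists_general_position (T : finType) (e : rel T) (m t : nat) :
  (12 <= m ^ 3)%N -> (#|T| <= m ^ 3)%N -> (2 * m ^ 2 <= 2 ^ t)%N ->
  (432 * (#|T| * #|edges e|) + 6750000 * t * (#|edges e| * #|edges e|.-1) < m ^ 3)%N ->
  exists f : T -> grid m, [/\ injective f,
    forall u v w, e u v -> w != u -> w != v -> u != v -> ~~ collinear (f u) (f v) (f w)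
  & forall u v u' v', e u v -> e u' v' -> uniq [:: u; v; u'; v'] ->
      ~~ coplanar (f u) (f v) (f u') (f v')].
Proof.
set n := #|T|; set k := #|edges e|; set N := (m ^ 3)%N => N12 nN mt small.
pose G : finType := grid m.
have cG : #|G| = N by rewrite card_grid.
have [i i_inj] : exists i : T -> G, injective i.
  have TG : (#|T| <= #|G|)%N by rewrite cG.
  exists (fun x => enum_val (widen_ord TG (enum_rank x))) => x y /enum_val_inj E.
  by apply: enum_rank_inj; apply: val_inj; move/(congr1 val): E.
pose B1 : {set 3.-tuple G} := [set [tuple q.1; q.2.1; q.2.2] | q : G * (G * G) &
  uniq [:: q.1; q.2.1; q.2.2] && collinear q.1 q.2.1 q.2.2]%SET.
pose B2 : {set 4.-tuple G} := [set [tuple q.1; q.2.1.1; q.2.1.2; q.2.2] | q : G * (G * G * G) &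
  uniq [:: q.1; q.2.1.1; q.2.1.2; q.2.2] &&
  (~~ collinear q.1 q.2.1.1 q.2.1.2 && coplanar q.1 q.2.1.1 q.2.1.2 q.2.2)]%SET.
have cB1 : (#|B1| <= 108 * N ^ 2)%N.
  apply: leq_trans (leq_imset_card _ _) _.
  have -> : (108 * N ^ 2 = m ^ 3 * (108 * m ^ 3))%N by rewrite /N; ring.
  apply: leq_trans (card_collinear m); apply: subset_leq_card.
  apply/fintype.subsetP => q; rewrite inE => /andP[/andP[q12 _] col].
  rewrite inE col andbT; by move: q12; rewrite !inE negb_or eq_sym => /andP[].
have cB2 : (#|B2| <= 421875 * t * N ^ 3)%N.
  apply: leq_trans (leq_imset_card _ _) _.
  have -> : (421875 * t * N ^ 3 = m ^ 3 * (421875 * m ^ 6 * t))%N by rewrite /N; ring.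
  apply: leq_trans (card_coplanar mt); apply: subset_leq_card.
  apply/fintype.subsetP => q; rewrite inE => /andP[_ cop].
  by rewrite inE.
pose A1 (s : 3.-tuple G) := [set g : {perm G} | map_tuple g s \in B1]%SET.
pose A2 (s : 4.-tuple G) := [set g : {perm G} | map_tuple g s \in B2]%SET.
have cA1 (s : 3.-tuple G) : uniq s -> (#|A1 s| * N <= 216 * N`!)%N.
  move=> us.
  have uB : forall b : 3.-tuple G, b \in B1 -> uniq b.
    by move=> b /imsetP[q]; rewrite inE => /andP[uq _] ->.
  have := card_perm_map_tuple us uB; rewrite -/(A1 s) cG => E.
  have N2 : (0 < N ^ 2)%N by rewrite expn_gt0; lia.
  rewrite -(leq_pmul2r N2).
  apply: (@leq_trans (2 * (#|A1 s| * N ^_ 3))%N).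
    have -> : (#|A1 s| * N * N ^ 2 = #|A1 s| * N ^ 3)%N by rewrite [(N ^ 3)%N]expnS mulnA.
    by rewrite mulnCA leq_mul2l ffact3_ge ?orbT.
  rewrite E; apply: (@leq_trans (2 * (108 * N ^ 2 * N`!)))%N.
    by rewrite leq_mul2l leq_mul2r cB1 !orbT.
  by move: (N`!) (N ^ 2)%N => x y; lia.
have cA2 (s : 4.-tuple G) : uniq s -> (#|A2 s| * N <= 843750 * t * N`!)%N.
  move=> us.
  have uB : forall b : 4.-tuple G, b \in B2 -> uniq b.
    by move=> b /imsetP[q]; rewrite inE => /andP[uq _] ->.
  have := card_perm_map_tuple us uB; rewrite -/(A2 s) cG => E.
  have N3 : (0 < N ^ 3)%N by rewrite expn_gt0; lia.
  rewrite -(leq_pmul2r N3).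
  apply: (@leq_trans (2 * (#|A2 s| * N ^_ 4))%N).
    have -> : (#|A2 s| * N * N ^ 3 = #|A2 s| * N ^ 4)%N by rewrite [(N ^ 4)%N]expnS mulnA.
    by rewrite mulnCA leq_mul2l ffact4_ge ?orbT.
  rewrite E; apply: (@leq_trans (2 * (421875 * t * N ^ 3 * N`!)))%N.
    by rewrite leq_mul2l leq_mul2r cB2 !orbT.
  by apply/eq_leq; ring.
pose E := [set p : T * T | e p.1 p.2]%SET.
have cE : (#|E| <= 2 * k)%N by exact: card_oriented_edges.
pose E1 := [set x : T * T * T | e x.1.1 x.1.2 && uniq [:: x.1.1; x.1.2; x.2]]%SET.
have cE1 : (#|E1| <= 2 * k * n)%N.
  apply: (@leq_trans #|finset.setX E [set: T]%SET|).
    by apply: subset_leq_card; apply/fintype.subsetP => x; rewrite !inE => /andP[-> _].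
  by rewrite cardsX cardsT leq_mul2r cE orbT.
pose E2 := [set x : T * T * (T * T) | [&& e x.1.1 x.1.2, e x.2.1 x.2.2 &
   uniq [:: x.1.1; x.1.2; x.2.1; x.2.2]]]%SET.
have cE2 : (#|E2| <= 8 * (k * k.-1))%N.
  (* Disjoint edges are distinct, so there are no pairs for [k <= 1]; otherwise
     [(2 * k) ^ 2 <= 8 * k * (k - 1)]. The vanishing at [k = 1] matters since [ln k] is then
     zero. *)
  have [k1|k2] := leqP k 1.
    suff -> : E2 = finset.set0 by rewrite cards0.
    apply/setP => -[[u v] [u' v']]; rewrite !inE /=; apply/negbTE.
    apply/and3P => -[euv euv' uq].
    have ed x y : e x y -> [set x; y]%SET \in edges e.
      by move=> exy; apply/imsetP; exists (x, y) => //; rewrite inE.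
    move/card_le1_eqP: k1 => /(_ _ _ (ed _ _ euv) (ed _ _ euv')) /setP /(_ u).
    by move: uq; rewrite /= !inE eqxx !negb_or => /and3P[/and3P[_ /negbTE -> /negbTE ->]].
  apply: (@leq_trans #|finset.setX E E|).
    by apply: subset_leq_card; apply/fintype.subsetP => x; rewrite !inE => /and3P[-> -> _].
  rewrite cardsX; apply: (@leq_trans (2 * k * (2 * k))); first exact: leq_mul.
  by rewrite -mulnA mulnCA; nia.
pose Bad := finset.setU
  (\bigcup_(x in E1) A1 [tuple i x.1.1; i x.1.2; i x.2])%SET
  (\bigcup_(x in E2) A2 [tuple i x.1.1; i x.1.2; i x.2.1; i x.2.2])%SET.
have cBad : (#|Bad| * N < N`! * N)%N.
  apply: (@leq_ltn_trans (2 * k * n * (216 * N`!) + 8 * (k * k.-1) * (843750 * t * N`!))%N).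
    apply: leq_trans (leq_mul (leq_card_setU _ _) (leqnn N)) _; rewrite mulnDl.
    apply: leq_add.
      apply: leq_trans (leq_mul (card_big_setU _ _ _) (leqnn N)) _.
      rewrite big_distrl /=.
      apply: leq_trans (leq_mul cE1 (leqnn _)); rewrite -sum_nat_const.
      apply: leq_sum => x; rewrite inE => /andP[_ ux]; apply: cA1.
      by rewrite -(map_inj_uniq i_inj) in ux.
    apply: leq_trans (leq_mul (card_big_setU _ _ _) (leqnn N)) _.
    rewrite big_distrl /=.
    apply: leq_trans (leq_mul cE2 (leqnn _)); rewrite -sum_nat_const.
    apply: leq_sum => x; rewrite inE => /and3P[_ _ ux]; apply: cA2.
    by rewrite -(map_inj_uniq i_inj) in ux.
  have -> : (2 * k * n * (216 * N`!) + 8 * (k * k.-1) * (843750 * t * N`!) =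
      N`! * (432 * (n * k) + 6750000 * t * (k * k.-1)))%N by ring.
  by rewrite ltn_pmul2l // fact_gt0.
have [g gB] : exists g : {perm G}, g \notin Bad.
  apply/existsP; rewrite -negb_forall; apply: contraL cBad => /forallP h.
  rewrite -leqNgt leq_mul2r; apply/orP; right.
  rewrite -cG -card_Sym; apply: subset_leq_card; apply/fintype.subsetP => g _; exact: h.
have nB1 u v w : e u v -> uniq [:: u; v; w] -> ~~ collinear (g (i u)) (g (i v)) (g (i w)).
  move=> euv uq; apply: contra gB => col; rewrite inE; apply/orP; left.
  apply/finset.bigcupP; exists (u, v, w); first by rewrite inE euv.
  rewrite inE; apply/imsetP; exists (g (i u), (g (i v), g (i w))); last exact: val_inj.
  rewrite inE /= col andbT.
  by rewrite -(map_inj_uniq (inj_comp (@perm_inj _ g) i_inj)) in uq.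
exists (fun x => g (i x)); split=> [x y /perm_inj /i_inj //|u v w euv wu wv uv|].
  by apply: nB1 => //; rewrite /= !inE negb_or uv !(eq_sym _ w) wu wv.
move=> u v u' v' euv euv' uq; apply: contra gB => cop; rewrite inE; apply/orP; right.
apply/finset.bigcupP; exists (u, v, (u', v')); first by rewrite inE /= euv euv'.
rewrite inE; apply/imsetP.
exists (g (i u), (g (i v), g (i u'), g (i v'))); last exact: val_inj.
have uq' : uniq [:: g (i u); g (i v); g (i u'); g (i v')].
  by rewrite -(map_inj_uniq (inj_comp (@perm_inj _ g) i_inj)) in uq.
(* [B2] requires the first three points not to be collinear, which [nB1] guarantees. *)
rewrite inE uq' cop andbT /=; apply: nB1 => //; move: uq.
by rewrite /= !inE !negb_or !andbT => /and3P[/and3P[-> -> _] /andP[-> _] _].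
Qed.

(** * From general position to a drawing *)

Lemma gdiffE (R : realType) m (a b : grid m) j :
  (gdiff a b j)%:~R = grid_point R b ord0 j - grid_point R a ord0 j.
Proof. by rewrite /gdiff rmorphB /= !mxE. Qed.

Lemma proportional_collinear (R : realType) m (a b c : grid m) (x : R) :
  (forall j, (gdiff a c j)%:~R = x * (gdiff a b j)%:~R) -> collinear a b c.
Proof.
move=> E; apply/forallP => i; rewrite -(intr_eq0 R) /cross rmorphB !rmorphM /= !E.
by apply/eqP; ring.
Qed.

(** The triple product is linear in its last argument and vanishes at the first two. The scalars are
    real, so the computation takes place after embedding the integers into [R]. *)
Lemma combination_coplanar (R : realType) m (a b c d : grid m) (x y : R) :
  (forall j, (gdiff a d j)%:~R = x * (gdiff a b j)%:~R + y * (gdiff a c j)%:~R) ->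
  coplanar a b c d.
Proof.
move=> E; rewrite /coplanar -(intr_eq0 R) /dot rmorph_sum /=.
have lin z : \sum_j (cross (gdiff a b) (gdiff a c) j)%:~R * (gdiff a z j)%:~R =
    (dot (cross (gdiff a b) (gdiff a c)) (gdiff a z))%:~R :> R.
  by rewrite /dot rmorph_sum; apply: eq_bigr => j _; rewrite rmorphM.
apply/eqP; transitivity (\sum_j
   (x * ((cross (gdiff a b) (gdiff a c) j)%:~R * (gdiff a b j)%:~R)
  + y * ((cross (gdiff a b) (gdiff a c) j)%:~R * (gdiff a c j)%:~R)) : R).
  by apply: eq_bigr => j _; rewrite rmorphM /= E; ring.
by rewrite big_split /= -!mulr_sumr !lin dot_crossl dot_crossr !mulr0 addr0.
Qed.

Lemma general_position_drawing (R : realType) m (T : finType) (e : rel T)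
    (f : T -> grid m) :
  irreflexive e -> injective f ->
  (forall u v w, e u v -> w != u -> w != v -> u != v -> ~~ collinear (f u) (f v) (f w)) ->
  (forall u v u' v', e u v -> e u' v' -> uniq [:: u; v; u'; v'] ->
      ~~ coplanar (f u) (f v) (f u') (f v')) ->
  grid_drawing R e f.
Proof.
move=> irr f_inj ncol ncop.
have neq u v : e u v -> u != v by apply: contraTneq => ->; rewrite irr.
split=> //.
- move=> u v w euv wu wv [t _ /= E].
  apply: (negP (ncol u v w euv wu wv (neq _ _ euv))).
  apply: (@proportional_collinear R m _ _ _ t) => j; rewrite !gdiffE -E !mxE; ring.
move=> u v u' v' euv euv' suv; apply/seteqP; split => // p [[s s01 /= Es] [t t01 /= Et]].
move: s01 t01; rewrite !set_itvE /= => /andP[s0 s1] /andP[t0 t1].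
have uv := neq _ _ euv; have uv' := neq _ _ euv'.
have t0' : t != 0 by rewrite gt_eqF.
have t1' : 1 - t != 0 by rewrite gt_eqF // subr_gt0.
have E j : s * (gdiff (f u) (f v) j)%:~R =
    (1 - t) * (gdiff (f u) (f u') j)%:~R + t * (gdiff (f u) (f v') j)%:~R.
  have := congr1 (fun A : 'rV[R]_3 => A ord0 j) (etrans Es (esym Et)).
  rewrite !gdiffE !mxE => h.
  apply/eqP; rewrite -subr_eq0; apply/eqP; move/eqP: h; rewrite -subr_eq0 => /eqP <-; ring.
have g0 a j : gdiff a a j = 0 by rewrite /gdiff subrr.
have Ev' j : (gdiff (f u) (f v') j)%:~R =
    (s * (gdiff (f u) (f v) j)%:~R - (1 - t) * (gdiff (f u) (f u') j)%:~R) / t.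
  by rewrite E; field.
have Eu' j : (gdiff (f u) (f u') j)%:~R =
    (s * (gdiff (f u) (f v) j)%:~R - t * (gdiff (f u) (f v') j)%:~R) / (1 - t).
  by rewrite E; field.
(* Distinct edges share at most one endpoint. If they share one, [E] makes the remaining vertex
   collinear with [u] and [v]; dividing by [t] or [1 - t] is possible as the crossing point is
   interior. *)
have [u'u|u'u] := eqVneq u' u.
  have v'v : v' != v by apply: contraNneq suv => ->; rewrite u'u.
  apply: (negP (ncol u v v' euv _ v'v uv)); first by rewrite -u'u eq_sym.
  apply: (@proportional_collinear R m _ _ _ (s / t)) => j; rewrite Ev' u'u g0; field.
  exact: t0'.
have [u'v|u'v] := eqVneq u' v.
  have v'u : v' != u by apply: contraNneq suv => ->; rewrite u'v finset.setUC.
  apply: (negP (ncol u v v' euv v'u _ uv)); first by rewrite -u'v eq_sym.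
  apply: (@proportional_collinear R m _ _ _ ((s - (1 - t)) / t)) => j; rewrite Ev' u'v; field.
  exact: t0'.
have ncu' := ncol u v u' euv u'u u'v uv.
have [v'u|v'u] := eqVneq v' u.
  apply: (negP ncu').
  apply: (@proportional_collinear R m _ _ _ (s / (1 - t))) => j; rewrite Eu' v'u g0; field.
  exact: t1'.
have [v'v|v'v] := eqVneq v' v.
  apply: (negP ncu').
  apply: (@proportional_collinear R m _ _ _ ((s - t) / (1 - t))) => j; rewrite Eu' v'v; field.
  exact: t1'.
apply: (negP (ncop u v u' v' euv euv' _)).
  by rewrite /= !inE !negb_or uv uv' !(eq_sym u) !(eq_sym v) u'u u'v v'u v'v.
apply: (@combination_coplanar R m _ _ _ _ (s / t) (- (1 - t) / t)) => j.
by rewrite Ev'; field.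
Qed.

(** * Size of the grid, and conclusion *)

Lemma ln2_ge_half (R : realType) : 1 / 2 <= ln 2 :> R.
Proof.
have := @le_ln1Dx R (- (1 / 2)) ltac:(lra).
have -> : 1 + - (1 / 2) = 2^-1 :> R by lra.
rewrite lnV ?posrE //; lra.
Qed.

(** Write [x = 12 * c * y * k ^+ 2 * ln k] and apply [ln z <= z] to [y], [12 * c] and [ln k]. The
    part with [y] then costs exactly [x / 4], and the hypothesis bounds the rest by less than
    [x / 4]. *)
Lemma logarithm_absorbed (R : realType) (c k x : R) : 1 <= c -> 2 <= k ->
  4 * c * (9 + 36 * c) * (k ^+ 2 * ln k) <= x ->
  c * k ^+ 2 * (2 + 4 / 3 * ln x) < x / 2.
Proof.
move=> c1 k2 xC.
have k0 : 0 < k by lra.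
have L2 : 1 / 2 <= ln k.
  by apply: le_trans (ln2_ge_half R) _; rewrite ler_ln ?posrE //; lra.
set L := ln k in L2 xC *; have L0 : 0 < L by lra.
have q0 : 0 < k ^+ 2 * L by rewrite mulr_gt0 // exprn_gt0.
set q := k ^+ 2 * L in q0 xC *.
have cc : 0 < 4 * c * (9 + 36 * c) by rewrite mulr_gt0 //; lra.
have x0 : 0 < x by apply: lt_le_trans xC; rewrite mulr_gt0.
pose y := x / (12 * c * q).
have y0 : 0 < y by rewrite divr_gt0 // !mulr_gt0 //; lra.
have c0 : c != 0 by rewrite gt_eqF //; lra.
have xE : x = y * (12 * c) * (k ^+ 2 * L).
  by rewrite /y /q; field; rewrite c0 (gt_eqF k0) (gt_eqF L0).
clearbody y; have lnx : ln x <= y + 12 * c + 3 * L.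
  rewrite xE lnM ?posrE ?mulr_gt0 ?exprn_gt0 //; try lra.
  rewrite lnM ?posrE ?mulr_gt0 //; try lra.
  rewrite [ln (k ^+ 2 * L)]lnM ?posrE ?exprn_gt0 // lnXn // -/L.
  have := ln_sublinear y0; have := ln_sublinear L0.
  have := @ln_sublinear R (12 * c) ltac:(lra).
  rewrite -mulr_natl; lra.
have ck : 0 <= c * k ^+ 2 by rewrite mulr_ge0 ?exprn_ge0 //; lra.
(* As [L >= 1 / 2], the constants are absorbed through [2 <= 4 * L] and [4 / 3 <= 3 * L]. *)
have bd : c * k ^+ 2 * (2 + 4 / 3 * ln x) <= c * k ^+ 2 * (L * (8 + 3 * (y + 12 * c))).
  rewrite ler_wpM2l //.
  have h : 0 <= (L - 1 / 2) * (y + 12 * c) by rewrite mulr_ge0 //; lra.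
  have h' : 0 <= L * (y + 12 * c) by rewrite mulr_ge0 //; lra.
  lra.
apply: (le_lt_trans bd).
have -> : c * k ^+ 2 * (L * (8 + 3 * (y + 12 * c))) = c * (8 + 36 * c) * q + x / 4.
  by rewrite xE /q; field.
have : 0 < 4 * c * q by rewrite !mulr_gt0 //; lra.
lra.
Qed.

(** [ln 2 >= 1 / 2] turns [(t - 2) * ln 2 <= 2 * ln m] into [t <= 2 + 4 * ln m] when [t > 2]. *)
Lemma exp_le_ln (R : realType) (m t : nat) : (0 < m)%N -> (2 ^ t <= 4 * m ^ 2)%N ->
  t%:R <= 2 + 4 / 3 * ln (m%:R ^+ 3) :> R.
Proof.
move=> m0 h.
have m0' : 0 < m%:R :> R by rewrite ltr0n.
have : ln (2 ^+ t) <= ln (2 ^+ 2 * m%:R ^+ 2) :> R.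
  rewrite ler_ln ?posrE ?mulr_gt0 ?exprn_gt0 //.
  by rewrite -!natrX -natrM ler_nat.
rewrite [ln (2 ^+ 2 * _)]lnM ?posrE ?exprn_gt0 // [ln (2 ^+ t)]lnXn // [ln (2 ^+ 2)]lnXn //.
rewrite [ln (m%:R ^+ 2)]lnXn // -[ln 2 *+ t]mulr_natl => h1.
have h2 := ln2_ge_half R.
rewrite lnXn //.
have h3 : 0 <= ln m%:R :> R by rewrite ln_ge0 // ler1n.
have [t2|t2] := lerP t%:R (2 : R); first by lra.
have h4 : (t%:R - 2) * (1 / 2) <= (t%:R - 2) * ln 2 :> R.
  by apply: ler_wpM2l => //; lra.
lra.
Qed.

(** Each of [a] and [b] is at most [a + b], and [C <= C ^+ 3]. *)
Lemma cube_root_bound (R : realType) (C a b y z : R) (p : nat) : 0 <= C -> 0 <= a -> 0 <= b ->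
  a ^+ 3 = y -> b ^+ 3 = z -> C * (a + b) <= p%:R -> 1 <= C ->
  C * y <= p%:R ^+ 3 /\ C * z <= p%:R ^+ 3.
Proof.
move=> C0 a0 b0 <- <- h C1.
have C3 : C <= C ^+ 3 by rewrite ler_eXnr.
have aux w : 0 <= w -> w <= a + b -> C * w ^+ 3 <= p%:R ^+ 3.
  move=> w0 wab; apply: (@le_trans _ _ (C ^+ 3 * w ^+ 3)).
    by rewrite ler_wpM2r // exprn_ge0.
  rewrite -exprMn lerXn2r ?nnegrE ?mulr_ge0 //.
  by apply: le_trans h; rewrite ler_wpM2l.
by split; apply: aux => //; lra.
Qed.

Lemma grid_size_sufficient (R : realType) (c1 c2 : nat) : exists C : R,
  forall n k m t : nat, (2 <= n)%N -> (1 <= k)%N -> (0 < m)%N ->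
    (2 ^ t <= 4 * m ^ 2)%N ->
    C * ((n * k)%:R `^ (1 / 3) + k%:R `^ (2 / 3) * (ln k%:R) `^ (1 / 3)) <= m%:R ->
    [/\ (12 <= m ^ 3)%N, (n <= m ^ 3)%N
      & (c1 * (n * k) + c2 * t * (k * k.-1) < m ^ 3)%N].
Proof.
pose d := c2%:R + 1 : R.
have d1 : 1 <= d by rewrite /d lerDr.
(* The summand 12 gives the first two conclusions and, with [2 * c1], keeps [c1 * (n * k)] below
   half of [m ^ 3]; the last summand is the constant in [logarithm_absorbed] for [d]. *)
pose C := 12 + 2 * c1%:R + 4 * d * (9 + 36 * d).
have c10 : 0 <= c1%:R :> R by [].
have dd : 0 <= 4 * d * (9 + 36 * d) by rewrite mulr_ge0 //; lra.
have C1 : 1 <= C by rewrite /C; lra.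
exists C => n k m t n2 k1 m0 tm h.
have k1' : 1 <= k%:R :> R by rewrite ler1n.
have lk0 : 0 <= ln k%:R :> R by rewrite ln_ge0.
have cube (y : R) : 0 <= y -> (y `^ (1 / 3)) ^+ 3 = y.
  move=> y0; rewrite -powR_mulrn ?powR_ge0 // -powRrM.
  have -> : 1 / 3 * 3 = 1 :> R by lra.
  by rewrite powRr1.
have cube2 (y : R) : 0 <= y -> (y `^ (2 / 3)) ^+ 3 = y ^+ 2.
  move=> y0; rewrite -powR_mulrn ?powR_ge0 // -powRrM.
  have -> : 2 / 3 * 3 = 2 :> R by lra.
  by rewrite powR_mulrn.
have [] := @cube_root_bound R C ((n * k)%:R `^ (1 / 3)) (k%:R `^ (2 / 3) * (ln k%:R) `^ (1 / 3))
  (n * k)%:R (k%:R ^+ 2 * ln k%:R) m _ _ _ _ _ h C1.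
- lra.
- exact: powR_ge0.
- by rewrite mulr_ge0 ?powR_ge0.
- exact: cube.
- by rewrite exprMn cube // cube2.
move=> hnk hk.
have nk2 : 2 <= (n * k)%:R :> R by rewrite ler_nat -[2%N]muln1 leq_mul.
have nkn : n%:R <= (n * k)%:R :> R by rewrite ler_nat leq_pmulr.
have nk0 : 0 <= c1%:R * (n * k)%:R :> R by rewrite mulr_ge0.
have dnk : 0 <= 4 * d * (9 + 36 * d) * (n * k)%:R by rewrite mulr_ge0.
rewrite /C in hnk.
have hx : 12 * (n * k)%:R + 2 * (c1%:R * (n * k)%:R) <= m%:R ^+ 3 :> R by lra.
split.
- by rewrite -(ler_nat R) natrX; lra.
- by rewrite -(ler_nat R) natrX; lra.
(* [logarithm_absorbed] needs [k >= 2]; at [k = 1] the factor [k.-1] removes the logarithmic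
   term. *)
have [k1e|k2] := leqP k 1.
  have /eqP k0 : (k.-1 == 0)%N by rewrite -subn1 subn_eq0.
  rewrite k0 !muln0 addn0 -(ltr_nat R) natrX natrM; lra.
rewrite -(ltr_nat R) natrD natrX [(c1 * _)%:R]natrM.
have hk' : 4 * d * (9 + 36 * d) * (k%:R ^+ 2 * ln k%:R) <= m%:R ^+ 3.
  apply: le_trans hk; apply: ler_wpM2r; last by rewrite /C; lra.
  by rewrite mulr_ge0 ?exprn_ge0.
have k2' : 2 <= k%:R :> R by rewrite ler_nat.
have la := logarithm_absorbed d1 k2' hk'.
have ht := exp_le_ln R m0 tm.
suff : (c2 * t * (k * k.-1))%:R <= d * k%:R ^+ 2 * (2 + 4 / 3 * ln (m%:R ^+ 3)) by lra.
apply: (@le_trans _ _ (d * k%:R ^+ 2 * t%:R)); last first.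
  by apply: ler_wpM2l => //; rewrite mulr_ge0 ?exprn_ge0 //; lra.
have -> : (c2 * t * (k * k.-1) = c2 * (k * k.-1) * t)%N by rewrite mulnAC.
rewrite natrM; apply: ler_wpM2r => //; rewrite natrM; apply: ler_pM => //.
  by rewrite /d lerDl.
by rewrite -natrX ler_nat -mulnn leq_mul2l leq_pred orbT.
Qed.

Theorem theorem3p1 (R : realType) :
  exists C : R,
    forall (n k : nat) (T : finType) (e : rel T),
      symmetric e -> irreflexive e ->
      #|T| = n -> #|edges e| = k -> (1 <= k)%N ->
      forall m : nat, (0 < m)%N ->
        C * ((n * k)%:R `^ (1 / 3) + k%:R `^ (2 / 3) * (ln k%:R) `^ (1 / 3))
          <= m%:R ->
        exists f : T -> grid m, grid_drawing R e f.
Proof.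
have [C HC] := grid_size_sufficient R 432 6750000.
exists C => n k T e _ irr nT ke k1 m m0 h.
have n2 : (2 <= n)%N.
  move: k1; rewrite -ke -nT => /card_gt0P[S /imsetP[[u v]]]; rewrite inE /= => euv _.
  apply/card_gt1P; exists u, v; split => //.
  by apply: contraTneq euv => ->; rewrite irr.
have m2 : (0 < 2 * m ^ 2)%N by rewrite muln_gt0 expn_gt0 m0.
(* [2 ^ t] is the least power of two above [2 * m ^ 2]: it bounds all norms of normals, and [t]
   stays logarithmic in [m]. *)
pose t := (trunc_log 2 (2 * m ^ 2)).+1.
have t_lower : (2 * m ^ 2 <= 2 ^ t)%N by rewrite ltnW // trunc_log_ltn.
have t_upper : (2 ^ t <= 4 * m ^ 2)%N.
  by rewrite /t expnS -[4%N]/(2 * 2)%N -mulnA leq_mul2l trunc_logP.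
have [N12 nN small] := HC n k m t n2 k1 m0 t_upper h.
move: nN small; rewrite -nT -ke => nN small.
have [f [f_inj ncol ncop]] := exists_general_position N12 nN t_lower small.
by exists f; apply: general_position_drawing.
Qed.
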